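(* Let $d,m\in\mathbb{N}$. (i) Let $\boldsymbol{\gamma}:\mathbb{R}^d\times\mathbb{R}^d\to\mathbb{R}^{m\times m}$ be a conditionally negative definite matrix-valued kernel. Then $\boldsymbol{\gamma}=(\gamma_{ij})_{i,j=1,\dots,m}$ has the form $$\gamma_{ij}(\boldsymbol{x},\boldsymbol{y})=g_i(\boldsymbol{x})+g_j(\boldsymbol{y})-C_{ij}(\boldsymbol{x},\boldsymbol{y}),\qquad \boldsymbol{x},\boldsymbol{y}\in\mathbb{R}^d,\ i,j=1,\dots,m,\qquad (\star)$$ for some functions $g_i:\mathbb{R}^d\to\mathbb{R}$, $i=1,\dots,m$, and some positive definite matrix-valued kernel $\boldsymbol{C}:\mathbb{R}^d\times\mathbb{R}^d\to\mathbb{R}^{m\times m}$. (ii) Conversely, if a function $\boldsymbol{\gamma}:\mathbb{R}^d\times\mathbb{R}^d\to\mathbb{R}^{m\times m}$ has the form $(\star)$ for some functions $g_i:\mathbb{R}^d\to\mathbb{R}$, $i=1,\dots,m$, and some positive definite matrix-valued kernel $\boldsymbol{C}$, then $\boldsymbol{\gamma}$ is conditionally negative definite. In particular, if moreover $\gamma_{ii}(\boldsymbol{x},\boldsymbol{x})=0$ for all $\boldsymbol{x}\in\mathbb{R}^d$ and $i=1,\dots,m$, then $\boldsymbol{\gamma}$ is a non-stationary pseudo cross-variogram.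
   Context: A matrix-valued kernel $\boldsymbol{C}:\mathbb{R}^d\times\mathbb{R}^d\to\mathbb{R}^{m\times m}$ with $C_{ij}(\boldsymbol{x},\boldsymbol{y})=C_{ji}(\boldsymbol{y},\boldsymbol{x})$ for all $\boldsymbol{x},\boldsymbol{y},i,j$ is called positive definite if $\sum_{i=1}^n\sum_{j=1}^n \boldsymbol{a}_i^\top\boldsymbol{C}(\boldsymbol{x}_i,\boldsymbol{x}_j)\boldsymbol{a}_j\ge 0$ for all $n\in\mathbb{N}$, $\boldsymbol{x}_1,\dots,\boldsymbol{x}_n\in\mathbb{R}^d$, $\boldsymbol{a}_1,\dots,\boldsymbol{a}_n\in\mathbb{R}^m$. A matrix-valued kernel $\boldsymbol{\gamma}:\mathbb{R}^d\times\mathbb{R}^d\to\mathbb{R}^{m\times m}$ is conditionally negative definite if $\gamma_{ij}(\boldsymbol{x},\boldsymbol{y})=\gamma_{ji}(\boldsymbol{y},\boldsymbol{x})$ for all $\boldsymbol{x},\boldsymbol{y},i,j$, and $\sum_{i=1}^n\sum_{j=1}^n \boldsymbol{a}_i^\top\boldsymbol{\gamma}(\boldsymbol{x}_i,\boldsymbol{x}_j)\boldsymbol{a}_j\le 0$ for all $n\in\mathbb{N}$, $\boldsymbol{x}_1,\dots,\boldsymbol{x}_n\in\mathbb{R}^d$, $\boldsymbol{a}_1,\dots,\boldsymbol{a}_n\in\mathbb{R}^m$ such that $\boldsymbol{1}_m^\top\sum_{k=1}^n\boldsymbol{a}_k=0$, where $\boldsymbol{1}_m=(1,\dots,1)^\top\in\mathbb{R}^m$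 (the sum of all components of all the $\boldsymbol{a}_k$ is zero). A non-stationary pseudo cross-variogram is a kernel $\boldsymbol{\gamma}:\mathbb{R}^d\times\mathbb{R}^d\to\mathbb{R}^{m\times m}$ of the form $\gamma_{ij}(\boldsymbol{x},\boldsymbol{y})=\frac12\mathrm{Var}(Z_i(\boldsymbol{x})-Z_j(\boldsymbol{y}))$, where $Z=(Z_1,\dots,Z_m)$ is a real $m$-variate random field on $\mathbb{R}^d$ such that $Z_i(\boldsymbol{x})-Z_j(\boldsymbol{y})$ is square integrable for all $\boldsymbol{x},\boldsymbol{y},i,j$. *)

(* Defs.v *)
From HB Require Import structures.
From mathcomp Require Import all_boot all_order all_algebra.
From mathcomp Require Import all_classical all_reals all_analysis.

Set Implicit Arguments.
Unset Strict Implicit.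
Unset Printing Implicit Defensive.

Import Order.TTheory GRing.Theory Num.Theory.
Import numFieldNormedType.Exports.

Local Open Scope ring_scope.

Definition mkernel (R : realType) (d m : nat) : Type :=
  'cV[R]_d -> 'cV[R]_d -> 'M[R]_m.

Definition sym_mkernel (R : realType) (d m : nat) (K : mkernel R d m) : Prop :=
  forall (x y : 'cV[R]_d) (i j : 'I_m), K x y i j = K y x j i.

(* The product under the sum is a 1 x 1 matrix; [0 0] extracts its entry. *)
Definition mkernel_form (R : realType) (d m : nat) (K : mkernel R d m)
    (n : nat) (x : 'I_n -> 'cV[R]_d) (a : 'I_n -> 'cV[R]_m) : R :=
  \sum_(i < n) \sum_(j < n) ((a i)^T *m K (x i) (x j) *m a j) 0 0.

Definition posdef_mkernel (R : realType) (d m : nat) (C : mkernel R d m) : Prop :=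
  sym_mkernel C /\
  forall (n : nat) (x : 'I_n -> 'cV[R]_d) (a : 'I_n -> 'cV[R]_m),
    0 <= mkernel_form C x a.

Definition cond_negdef_mkernel (R : realType) (d m : nat)
    (gamma : mkernel R d m) : Prop :=
  sym_mkernel gamma /\
  forall (n : nat) (x : 'I_n -> 'cV[R]_d) (a : 'I_n -> 'cV[R]_m),
    (const_mx 1 : 'cV[R]_m)^T *m (\sum_(k < n) a k) = 0 ->
    mkernel_form gamma x a <= 0.

(* The m-variate field is given by its components. Only the differences
   Z_i(x) - Z_j(y), not the Z_i(x) themselves, are required to be in L^2. *)
Definition pseudo_cross_variogram (R : realType) (d m : nat)
    (gamma : mkernel R d m) : Prop :=
  exists (disp : measure_display) (T : measurableType disp)
    (P : probability T R) (Z : 'I_m -> 'cV[R]_d -> {RV P >-> R}),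
    forall (x y : 'cV[R]_d) (i j : 'I_m),
      (Z i x \- Z j y : T -> R) \in Lfun P 2%:E /\
      (gamma x y i j)%:E = ((2^-1)%R%:E * 'V_P[(Z i x \- Z j y)%R])%E.

Definition variogram_decomp (R : realType) (d m : nat)
    (gamma : mkernel R d m) (g : 'I_m -> 'cV[R]_d -> R) (C : mkernel R d m) : Prop :=
  forall (x y : 'cV[R]_d) (i j : 'I_m),
    gamma x y i j = g i x + g j y - C x y i j.

(* Main.v *)
(** A conditionally negative definite kernel [gamma] is turned into a positive
    definite one by adding to a given combination of points a base point whose
    weight makes the total weight vanish.

    The converse rests on realizing an arbitrary positive definite kernel, on
    the uncountable set of pairs (location, component), as a covariance. As only
    second moments matter, no Gaussian law is needed: it is enough to have a
    probability space carrying as many orthonormal centered variables as there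
    are indices. Coin tossing indexed by that set provides them, as the signs
    of the coins; countable additivity on cylinders is compactness. Zorn's lemma
    then builds the field one index at a time: by completeness of L^2 there is
    a Y having the prescribed inner products with the variables chosen so far
    and second moment at most the prescribed one, and the missing second moment
    is supplied by a multiple of the sign of the new coin. *)

Require Import Defs.
From HB Require Import structures.
From mathcomp Require Import all_boot all_order all_algebra.
From mathcomp Require Import all_classical all_reals all_analysis.
From mathcomp Require Import measurable_realfun ring lra.
Set Implicit Arguments.
Unset Strict Implicit.
Unset Printing Implicit Defensive.
Import Order.TTheory GRing.Theory Num.Theory.
Import numFieldNormedType.Exports.
Local Open Scope classical_set_scope.
Local Open Scope ring_scope.

(** A separate name for the function space, so that the algebra of cylinders can be attached to
    it. *)
Definition coins (S : choiceType) : Type := S -> bool.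

HB.instance Definition _ (S : choiceType) := gen_eqMixin (coins S).
HB.instance Definition _ (S : choiceType) := gen_choiceMixin (coins S).
HB.instance Definition _ (S : choiceType) := isPointed.Build (coins S) (fun=> false).

(** * Fair coin tossing over an arbitrary index set *)

Section finite_support.
Context {S : choiceType}.
Implicit Types (L K : seq S) (w : coins S) (s t : S).

(** With [V := Prop] this covers events decided by the coins in [L]. *)
Definition supported (V : Type) L (h : coins S -> V) :=
  forall w w', {in L, w =1 w'} -> h w = h w'.

Lemma supported_sub (V : Type) L K (h : coins S -> V) :
  {subset L <= K} -> supported L h -> supported K h.
Proof. by move=> LK hL w w' ww'; apply: hL => s /LK; exact: ww'. Qed.

Lemma supported_comp (U V : Type) (g : U -> V) L (h : coins S -> U) :
  supported L h -> supported L (g \o h).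
Proof. by move=> hL w w' /hL /= ->. Qed.

Definition set_coin s b w : coins S := fun t => if t == s then b else w t.

Lemma set_coinC s t b c w : s != t ->
  set_coin s b (set_coin t c w) = set_coin t c (set_coin s b w).
Proof.
move=> st; apply/funext => u; rewrite /set_coin.
by case: (eqVneq u s) => [->|//]; rewrite (negbTE st).
Qed.

Context {R : realType}.
Implicit Types h : coins S -> R.

(* Averaging out the coin [s]; doing so for every coin of a support of [h]
   yields the expectation of [h]. *)
Definition avg s h w : R := (h (set_coin s true w) + h (set_coin s false w)) / 2.

Definition avgs L h := foldr avg h L.

Lemma avgC s t h : avg s (avg t h) = avg t (avg s h).
Proof.
case: (eqVneq s t) => [->//|st]; apply/funext => w; rewrite /avg.
rewrite !(set_coinC _ _ _ st); ring.
Qed.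

Lemma avgsC L K h : avgs L (avgs K h) = avgs K (avgs L h).
Proof.
have avg_avgs s M g : avg s (avgs M g) = avgs M (avg s g).
  by elim: M => //= t M <-; rewrite avgC.
by elim: L => //= s L ->; rewrite avg_avgs.
Qed.

Lemma avgs_cst L (c : R) : avgs L (fun=> c) = (fun=> c).
Proof. by elim: L => //= s L ->; apply/funext => w; rewrite /avg; field. Qed.

Lemma avgs_lin L (a : R) h1 h2 :
  avgs L (fun w => a * h1 w + h2 w) = fun w => a * avgs L h1 w + avgs L h2 w.
Proof.
by elim: L => //= s L ->; apply/funext => w; rewrite /avg; ring.
Qed.

Lemma le_avgs L h1 h2 : (forall w, h1 w <= h2 w) ->
  forall w, avgs L h1 w <= avgs L h2 w.
Proof.
by move=> h12; elim: L => //= s L IH w; rewrite /avg ler_pM2r// lerD.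
Qed.

Lemma avgs_supported L K h : supported L h ->
  supported [seq s <- L | s \notin K] (avgs K h).
Proof.
elim: K => [|s K IH] hL /=.
  by apply: supported_sub hL => s; rewrite mem_filter.
move=> w w' ww'; rewrite /avg; congr ((_ + _) / 2); apply: IH => // t;
  rewrite mem_filter => /andP[tK tL]; rewrite /set_coin; case: eqVneq => // ts;
  by apply: ww'; rewrite mem_filter inE negb_or ts tK.
Qed.

(** Averaging over a support leaves a constant, which further averaging fixes. As the two averagings
    commute, both constants agree. *)
Lemma avgs_indep L K h w w' : supported L h -> supported K h ->
  avgs L h w = avgs K h w'.
Proof.
move=> hL hK.
have avgs_const M : supported M h -> avgs M h = fun=> avgs M h point.
  move=> hM; apply/funext => v.
  by apply: (avgs_supported (K := M) hM) => s; rewrite mem_filter => /andP[/negP].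
have : avgs K (avgs L h) w = avgs L (avgs K h) w by rewrite avgsC.
by rewrite (avgs_const L)// (avgs_const K)// !avgs_cst.
Qed.

End finite_support.

(** * The coin measure, extended from cylinders *)

Section coin_measure.
Context {S : choiceType} {R : realType}.
Local Notation T := (coins S).

Definition cylinder (A : set T) := exists L, supported L A.

Lemma cylinder0 : cylinder set0.
Proof. by exists [::]. Qed.

Lemma cylinderU : setU_closed cylinder.
Proof.
move=> A B [L AL] [K BK]; exists (L ++ K) => w w' ww'; rewrite /setU /mkset.
rewrite (AL w w') ?(BK w w')// => s sL; apply: ww'; rewrite mem_cat sL ?orbT//.
Qed.

Lemma cylinderC : setC_closed cylinder.
Proof. by move=> A [L AL]; exists L; exact: supported_comp AL. Qed.

Fact coins_display : measure_display. Proof. by []. Qed.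

HB.instance Definition _ := @isAlgebraOfSets.Build coins_display (coins S)
  cylinder cylinder0 cylinderU cylinderC.

(** Every finite support gives the same value, by [avgs_indep]; the default [[::]] serves functions
    without one. *)
Definition coin_mean (h : T -> R) : R :=
  avgs (xget [::] [set L | supported L h]) h point.

Lemma coin_meanE L h : supported L h -> coin_mean h = avgs L h point.
Proof.
move=> hL; apply: avgs_indep => //.
exact: (@xgetI _ [::] [set K | supported K h] L hL).
Qed.

Lemma supported_indic L (A : set T) :
  supported L A -> supported L (\1_A : T -> R).
Proof.
move=> AL w w' ww'; rewrite !indicE; congr (nat_of_bool _)%:R.
by apply/idP/idP; rewrite !inE (AL w w').
Qed.

Lemma coin_mean_cst (c : R) : coin_mean (fun=> c) = c.
Proof. by rewrite (@coin_meanE [::]). Qed.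

Lemma coin_mean_lin L (a : R) h1 h2 : supported L h1 -> supported L h2 ->
  coin_mean (fun w => a * h1 w + h2 w) = a * coin_mean h1 + coin_mean h2.
Proof.
move=> L1 L2; rewrite !(@coin_meanE L)// ?avgs_lin// => w w' ww'.
by rewrite (L1 w w')// (L2 w w').
Qed.

Lemma le_coin_mean L h1 h2 : supported L h1 -> supported L h2 ->
  (forall w, h1 w <= h2 w) -> coin_mean h1 <= coin_mean h2.
Proof. by move=> L1 L2 h12; rewrite !(@coin_meanE L)//; exact: le_avgs. Qed.

Lemma common_support n (F : nat -> set T) : (forall k, measurable (F k)) ->
  exists L, forall k, (k < n)%N -> supported L (F k).
Proof.
move=> mF; elim: n => [|n [L FL]]; first by exists [::].
have [K FK] := mF n; exists (L ++ K) => k; rewrite ltnS leq_eqVlt.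
case/predU1P => [->|kn]; [move: FK|move: (FL k kn)]; apply: supported_sub => s;
  by rewrite mem_cat => ->; rewrite ?orbT.
Qed.

Lemma supported_sum n L (F : nat -> T -> R) :
  (forall k, (k < n)%N -> supported L (F k)) ->
  supported L (fun w => \sum_(k < n) F k w).
Proof. by move=> FL w w' ww'; apply: eq_bigr => k _; exact: FL. Qed.

Lemma coin_mean_sum n L (F : nat -> T -> R) :
  (forall k, (k < n)%N -> supported L (F k)) ->
  coin_mean (fun w => \sum_(k < n) F k w) = \sum_(k < n) coin_mean (F k).
Proof.
elim: n => [_|n IH FL].
  rewrite big_ord0 (_ : (fun _ => _) = fun=> 0) ?coin_mean_cst//.
  by apply/funext => w; rewrite big_ord0.
have FL' k : (k < n)%N -> supported L (F k) by move=> kn; apply: FL; rewrite ltnW.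
rewrite big_ord_recr/= -IH// addrC -[coin_mean (F n)]mul1r.
rewrite -(coin_mean_lin 1 (FL n (ltnSn n)) (supported_sum FL')); congr coin_mean.
by apply/funext => w; rewrite big_ord_recr/= mul1r addrC.
Qed.

Definition coin_content (A : set T) : \bar R := (coin_mean \1_A)%:E.

Lemma coin_content_ge0 A : (0 <= coin_content A)%E.
Proof.
rewrite lee_fin /coin_mean; set L := xget _ _.
by rewrite -[leLHS]/((fun=> 0) (point : T)) -(avgs_cst L); exact: le_avgs.
Qed.

Lemma coin_content_additive : measure_function.semi_additive coin_content.
Proof.
move=> F n mF tF mUF; have [L FL] := common_support n mF.
rewrite /coin_content sumEFin -(@coin_mean_sum n L (fun k => \1_(F k))); last first.
  by move=> k kn; apply: supported_indic; exact: FL.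
congr (coin_mean _)%:E; apply/funext => w; rewrite -bigcup_mkord indicE.
have [|/negP nU] := boolP (w \in _).
  rewrite inE => -[k /= kn Fkw].
  rewrite (bigD1 (Ordinal kn))//= indicE mem_set// big1 ?addr0// => i ik.
  rewrite indicE memNset// => Fiw; move/eqP: ik; apply; apply/val_inj => /=.
  by apply: (tF i k) => //; exists w.
rewrite big1// => i _; rewrite indicE memNset// => Fiw; apply: nU.
by rewrite inE; exists i => /=.
Qed.

HB.instance Definition _ := @isContent.Build _ (coins S) R coin_content
  coin_content_ge0 coin_content_additive.

(* Cylinders are clopen in the compact product topology, so a countable cover
   of a cylinder by cylinders has a finite subcover. *)
Lemma cylinder_finite_cover (A : set T) (F : nat -> set T) :
  measurable A -> (forall k, measurable (F k)) -> A `<=` \bigcup_k F k ->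
  exists n, A `<=` \bigcup_(k < n) F k.
Proof.
move=> [L AL] mF AF.
have /compact_near_coveringP cov :
    compact [set _ : prod_topology (fun _ : S => bool) | True].
  rewrite (_ : mkset _ = [set f | forall s, setT (f s)]).
    exact: (@tychonoff S (fun=> bool) (fun=> setT) (fun=> bool_compact)).
  by apply/seteqP; split.
have agree_nbhs (w : prod_topology (fun _ : S => bool)) (K : seq S) :
    nbhs w [set w' : prod_topology (fun _ : S => bool) | {in K, w =1 w'}].
  elim: K => [|s K IH]; first by apply: (@filterS _ (nbhs w) _ setT);
    [move=> w' _ s|exact: filterT].
  have := @proj_continuous S (fun=> bool) s w [set w s].
  move=> /(_ (discrete_set1 _)); apply: filterS2 IH => w' wK /= ws t.
  by rewrite inE => /predU1P[->|/wK//]; rewrite -ws.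
(* Compactness in near-covering form, along [\oo]. Near a point of [A], agreement on the support of
   some [F k] containing it suffices; near a point outside [A], agreement on [L] prevents entering
   [A]. *)
have [w _|n _ nP] :=
  cov nat \oo (fun n w => A w -> (\bigcup_(k < n) F k) w) (@eventually_filter).
  have [Aw|nAw] := pselect (A w).
    have [k _ Fkw] := AF _ Aw; have [K FK] := mF k.
    exists ([set w' | {in K, w =1 w'}], [set n | (k < n)%N]).
      by split; [exact: agree_nbhs|exists k.+1].
    by move=> [w' n] /= [ww' kn] _; exists k => //; rewrite -(FK w w').
  exists ([set w' | {in L, w =1 w'}], setT).
    by split; [exact: agree_nbhs|exact: filterT].
  by move=> [w' n] /= [ww' _]; rewrite -(AL w w').
by exists n => w; apply: (nP n) => /=.
Qed.

(** A finite subcover reduces the claim to monotonicity and additivity of [coin_mean] over finitely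
    many coins. *)
Lemma coin_content_sigma_subadditive :
  measurable_subset_sigma_subadditive coin_content.
Proof.
move=> A F mF mA AF; have [n AFn] := cylinder_finite_cover mA mF AF.
have [L FL] := common_support n mF; have [K AK] := mA.
apply: le_trans (nneseries_lim_ge n _); last by move=> *; exact: coin_content_ge0.
rewrite big_mkord sumEFin lee_fin.
have FL' k : (k < n)%N -> supported (K ++ L) (\1_(F k) : T -> R).
  move=> kn; apply: (@supported_sub _ _ L) => [s sL|].
    by rewrite mem_cat sL orbT.
  exact/supported_indic/FL.
rewrite -(@coin_mean_sum n (K ++ L) (fun k => \1_(F k)))//.
apply: (@le_coin_mean (K ++ L)).
- apply: (@supported_sub _ _ K) => [s sK|]; first by rewrite mem_cat sK.
  exact: supported_indic.
- exact: (@supported_sum n _ (fun k => \1_(F k))).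
- move=> w; rewrite indicE.
  have [|] := boolP (w \in A); last by rewrite sumr_ge0.
  rewrite inE => /AFn[k /= kn Fkw].
  by rewrite (bigD1 (Ordinal kn))//= indicE mem_set// lerDl sumr_ge0.
Qed.

HB.instance Definition _ := @Content_SigmaSubAdditive_isMeasure.Build _ R
  (coins S) coin_content coin_content_sigma_subadditive.

(** Caratheodory extension passes from the algebra of cylinders to the sigma-algebra it
    generates. *)
Definition coinsT := g_sigma_algebraType (@measurable _ T).

Definition coin_measure : set coinsT -> \bar R := measure_extension coin_content.

HB.instance Definition _ := Measure.on coin_measure.

Lemma coin_measureE (A : set T) :
  cylinder A -> coin_measure A = (coin_mean \1_A)%:E.
Proof.
by move=> mA; rewrite /coin_measure /= /measure_extension measurable_mu_extE.
Qed.

Lemma coin_measure_setT : coin_measure setT = 1%E.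
Proof.
rewrite coin_measureE; last by exists [::].
by rewrite indicT coin_mean_cst.
Qed.

HB.instance Definition _ :=
  Measure_isProbability.Build _ _ R coin_measure coin_measure_setT.

Lemma cylinder_head s : cylinder [set w : T | w s].
Proof. by exists [:: s] => w w' /(_ s); rewrite mem_seq1 eqxx /= => ->. Qed.

Lemma cylinder_agree s t : cylinder [set w : T | w s == w t].
Proof. by exists [:: s; t] => w w' ww'; rewrite /mkset !ww'// !inE eqxx ?orbT. Qed.

Lemma coin_measure_head s : coin_measure [set w : T | w s] = 2^-1%:E.
Proof.
rewrite (coin_measureE (cylinder_head s)).
have supp : supported [:: s] [set w : T | w s].
  by move=> w w' /(_ s); rewrite mem_seq1 eqxx /= => ->.
have headE w : \1_[set w : T | w s] w = (w s)%:R :> R.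
  by rewrite indicE; congr (nat_of_bool _)%:R; apply/idP/idP; rewrite inE.
rewrite (coin_meanE (supported_indic supp)) /= /avg !headE /set_coin eqxx.
by rewrite addr0 mul1r.
Qed.

Lemma coin_measure_agree s t : s != t ->
  coin_measure [set w : T | w s == w t] = 2^-1%:E.
Proof.
move=> st; rewrite (coin_measureE (cylinder_agree s t)).
have supp : supported [:: s; t] [set w : T | w s == w t].
  by move=> w w' ww'; rewrite /mkset !ww'// !inE eqxx ?orbT.
have agreeE w : \1_[set w : T | w s == w t] w = (w s == w t)%:R :> R.
  by rewrite indicE; congr (nat_of_bool _)%:R; apply/idP/idP; rewrite inE.
rewrite (coin_meanE (supported_indic supp)) /= /avg !agreeE /set_coin.
by rewrite !eqxx (negbTE st) /=; congr EFin; field.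
Qed.

End coin_measure.

(** * The Hilbert space of square integrable random variables *)

Section L2.
Context {d : measure_display} {T : measurableType d} {R : realType}.
Context {P : probability T R}.

Local Notation L2 := (LfunType P (lee1n 2)).
Implicit Types (f g h : L2) (a : R).

(** Elements of [L2] are functions, not classes modulo null sets, so this form is only positive
    semidefinite. *)
Definition ip f g : R := (\int[P]_x (f x * g x))%R.

Lemma L2_mul_integrable f g : P.-integrable setT (fun x => (f x * g x)%:E).
Proof. by apply/Lfun1_integrable/Lfun2_mul_Lfun1; exact: LfunP. Qed.

Lemma ip_EFin f g : (ip f g)%:E = (\int[P]_x (f x * g x)%:E)%E.
Proof.
rewrite /ip /Rintegral fineK//; apply: integrable_fin_num => //.
exact: L2_mul_integrable.
Qed.

Lemma ipC f g : ip f g = ip g f.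
Proof. by apply: eq_Rintegral => x _; rewrite mulrC. Qed.

Lemma ip_linl a f g h : ip (a *: f + g) h = a * ip f h + ip g h.
Proof.
rewrite /ip -RintegralZl//; last exact: L2_mul_integrable.
rewrite -RintegralD//; last exact: L2_mul_integrable.
- by apply: eq_Rintegral => x _ /=; rewrite mulrDl mulrA.
- rewrite (_ : _ \o _ = fun x => (a%:E * (f x * h x)%:E)%E)//.
  by apply: integrableZl => //; exact: L2_mul_integrable.
Qed.

Lemma ipDl f g h : ip (f + g) h = ip f h + ip g h.
Proof. by rewrite -[f]scale1r ip_linl mul1r scale1r. Qed.

Lemma ip0l h : ip 0 h = 0.
Proof. by have := ip_linl 1 0 0 h; rewrite scaler0 addr0; lra. Qed.

Lemma ipZl a f h : ip (a *: f) h = a * ip f h.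
Proof. by have := ip_linl a f 0 h; rewrite addr0 ip0l addr0. Qed.

Lemma ipNl f h : ip (- f) h = - ip f h.
Proof. by rewrite -scaleN1r ipZl mulN1r. Qed.

Lemma ipDr f g h : ip h (f + g) = ip h f + ip h g.
Proof. by rewrite !(ipC h) ipDl. Qed.

Lemma ipZr a f h : ip h (a *: f) = a * ip h f.
Proof. by rewrite !(ipC h) ipZl. Qed.

Lemma ipNr f h : ip h (- f) = - ip h f.
Proof. by rewrite !(ipC h) ipNl. Qed.

Lemma ip_ge0 f : 0 <= ip f f.
Proof. by apply: Rintegral_ge0 => x _; rewrite -expr2 sqr_ge0. Qed.

Lemma ip_sumZl (I : Type) (r : seq I) (F : I -> R) (G : I -> L2) h :
  ip (\sum_(i <- r) F i *: G i) h = \sum_(i <- r) F i * ip (G i) h.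
Proof.
by elim: r => [|i r IH]; rewrite ?big_nil ?ip0l// !big_cons ip_linl IH.
Qed.

(** Expand the squared norms of [f + a *: g] and [f - a *: g]. The free weight [a] lets this stand
    in for Cauchy-Schwarz. *)
Lemma norm_ip_AMGM a f g : 2 * a * `|ip f g| <= ip f f + a ^+ 2 * ip g g.
Proof.
have := ip_ge0 (f + a *: g); have := ip_ge0 (f - a *: g).
rewrite !(ipDl, ipDr, ipNl, ipNr, ipZl, ipZr) (ipC g f).
by have [?|?] := ger0P (ip f g); nra.
Qed.

Lemma in_Lfun2 (Y : T -> R) : measurable_fun setT Y ->
  (\int[P]_x (Y x ^+ 2)%:E < +oo)%E -> Y \in Lfun P 2%:E.
Proof.
move=> mY Yoo; rewrite inE; apply/andP; split; rewrite inE//=.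
rewrite /finite_norm unlock /Lnorm poweR_lty//.
by under eq_integral do rewrite /= powR_mulrn// real_normK ?num_real//.
Qed.

(** An upper limit is measurable and exists at every point; [fine] sends infinite values to 0. *)
Let ae_lim (X : nat -> L2) x := fine (limn_esup (fun n => (X n x)%:E)).

Let cauchy (X : nat -> L2) := forall n m, (n <= m)%N ->
  ip (X m - X n) (X m - X n) <= 4^-1 ^+ n.

(** The increments have summable means, so their sum is integrable, hence finite almost everywhere;
    there the telescoping series converges absolutely. *)
Let cauchy_ae (X : nat -> L2) : cauchy X ->
  {ae P, forall x, (fun n => (X n x)%:E) @ \oo --> (ae_lim X x)%:E}.
Proof.
move=> cX.
pose D n x : R := `|X n.+1 x - X n x|.
have mD n : measurable_fun setT (fun x => (D n x)%:E).
  by apply/measurable_EFinP; apply: measurableT_comp => //; exact: measurable_funB.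
have D0 n x : (0 <= (D n x)%:E)%E by rewrite lee_fin /D normr_ge0.
(* The bound is 2^-n, written in the shape of the geometric series summed below. *)
have intD n : (\int[P]_x (D n x)%:E <= (2 / (2 ^ (n + 1))%:R)%:E)%E.
  pose p : R := 2 ^+ n; have p0 : 0 < p by rewrite exprn_gt0.
  have pV : p * p^-1 = 1 by rewrite mulfV// gt_eqF.
  have -> : 2 / (2 ^ (n + 1))%:R = p / 2 * (p^-1 * p^-1) + p^-1 / 2 :> R.
    by rewrite natrX exprD -/p; field; rewrite gt_eqF.
  (* AM-GM, with weights making both terms of order 2^-n after integration. *)
  have leD x : ((D n x)%:E <= (p / 2)%:E *
      ((X n.+1 - X n) x * (X n.+1 - X n) x)%:E + (p^-1 / 2)%:E)%E.
    rewrite /D -EFinM -EFinD lee_fin -[(X n.+1 - X n) x]/(X n.+1 x - X n x).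
    set z := _ - _; rewrite -[z * z]expr2 -(real_normK (num_real z)).
    rewrite -(ler_pM2l p0); have := sqr_ge0 (p * `|z| - 1).
    set q := p^-1 in pV *; set y := `|z|.
    have -> : p * (p / 2 * y ^+ 2 + q / 2) = ((p * y) ^+ 2 + p * q) / 2 by field.
    rewrite pV; nra.
  apply: (@le_trans _ _ (\int[P]_x ((p / 2)%:E *
      ((X n.+1 - X n) x * (X n.+1 - X n) x)%:E + (p^-1 / 2)%:E))%E).
    apply: ge0_le_integral => //.
    apply/measurable_EFinP; apply: measurable_funD => //.
    apply: measurable_funM => //.
    exact: measurable_funM.
  rewrite integralD//; last 2 first.
  - by apply: integrableZl => //; exact: L2_mul_integrable.
  - exact: finite_measure_integrable_cst.
  rewrite integralZl//; last exact: L2_mul_integrable.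
  have -> : (\int[P]_x (p^-1 / 2)%:E = (p^-1 / 2)%:E)%E.
    by rewrite (integral_cst P measurableT) /= probability_setT mule1.
  rewrite -ip_EFin -EFinM -EFinD.
  rewrite lee_fin lerD2r ler_pM2l ?divr_gt0//.
  apply: (le_trans (cX n n.+1 (leqnSn n))).
  by rewrite -invfM -exprMn exprVn -natrM.
have intS : (\int[P]_x (\sum_(n <oo) (D n x)%:E) < +oo)%E.
  rewrite integral_nneseries//.
  apply: (@le_lt_trans _ _ (\sum_(n <oo) (2 / (2 ^ (n + 1))%:R)%:E)%E).
    by apply: lee_nneseries => [n _ _|n _]; [exact: integral_ge0|exact: intD].
  by rewrite (cvg_lim _ (@cvg_geometric_eseries_half R 2 0))// ltry.
have /integrable_ae : P.-integrable setT (fun x => \sum_(n <oo) (D n x)%:E)%E.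
  apply/integrableP; split; first exact: ge0_emeasurable_sum.
  under eq_integral do rewrite gee0_abs ?nneseries_ge0//.
  exact: intS.
move=> /(_ measurableT); apply: filterS => x /(_ I) Sfin.
suff /cvg_ex[l Xl] : cvgn (fun n => (X n x : R^o)).
  have XlE : (fun n => (X n x)%:E) @ \oo --> l%:E by apply: cvg_EFin => //; exact: nearW.
  by rewrite /ae_lim is_cvg_limn_esupE ?(cvg_lim _ XlE)//;
    apply/cvg_ex; exists l%:E.
rewrite (_ : (fun n => _) =
    fun n => X 0%N x + series (telescope (fun n => X n x)) n).
  apply: is_cvgD; first exact: is_cvg_cst.
  apply: normed_cvg; apply: nondecreasing_is_cvgn.
    by apply: nondecreasing_series => n _ _; exact: normr_ge0.
  exists (fine (\sum_(n <oo) (D n x)%:E)) => _ [n _ <-].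
  rewrite -lee_fin fineK// /series /= -sumEFin.
  by apply: nneseries_lim_ge => *; exact: D0.
by apply/funext => n; rewrite -eq_sum_telescope.
Qed.

(** Fatou's lemma carries the Cauchy bound to the almost everywhere limit. Square integrability
    follows from [Y = X 0 - (X 0 - Y)]. *)
Lemma L2_complete (X : nat -> L2) :
  (forall n m, (n <= m)%N -> ip (X m - X n) (X m - X n) <= 4^-1 ^+ n) ->
  exists Y : L2, forall n, ip (X n - Y) (X n - Y) <= 4^-1 ^+ n.
Proof.
move=> cX; pose Y := ae_lim X.
have mX n : measurable_fun setT (X n : T -> R) by [].
have mY : measurable_fun setT Y.
  apply: measurableT_comp => //; apply: measurable_fun_limn_esup => n.
  exact/measurable_EFinP.
have mXY n : measurable_fun setT (fun x => ((X n x - Y x) ^+ 2)%:E).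
  by apply/measurable_EFinP; apply: measurable_funX; exact: measurable_funB.
have mXX n m : measurable_fun setT (fun x => ((X m x - X n x) ^+ 2)%:E).
  by apply/measurable_EFinP; apply: measurable_funX; exact: measurable_funB.
have YX n : (\int[P]_x ((X n x - Y x) ^+ 2)%:E <= (4^-1 ^+ n)%:E)%E.
  apply: (@le_trans _ _
      (\int[P]_x limn_einf (fun m => ((X m x - X n x) ^+ 2)%:E))%E).
    apply: ae_ge0_le_integral => //.
    - by move=> x _; rewrite lee_fin sqr_ge0.
    - move=> x _; rewrite limn_einf_lim; apply: lime_ge; first exact: is_cvg_einfs.
      apply: nearW => k; apply: le_ereal_inf_tmp => _ [m _ <-].
      by rewrite lee_fin sqr_ge0.
    - rewrite (_ : (fun _ => _) = fun x =>
          - limn_esup (fun m => - ((X m x - X n x) ^+ 2)%:E))%E.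
        apply: measurableT_comp => //; apply: measurable_fun_limn_esup => m.
        exact: measurableT_comp.
      by apply/funext => x; rewrite limn_esupN oppeK.
    - apply: filterS (cauchy_ae cX) => x XY _.
      have XYn : (fun m => ((X m x - X n x) ^+ 2)%:E) @ \oo -->
          ((Y x - X n x) ^+ 2)%:E.
        apply: cvg_EFin; first exact: nearW.
        have XR : (fun m => X m x : R^o) @ \oo --> (Y x : R^o).
          by move/fine_cvgP : XY => [].
        have XB : (fun m => X m x - X n x : R^o) @ \oo -->
            (Y x - X n x : R^o).
          by apply: cvgB => //; exact: cvg_cst.
        by under eq_fun do rewrite expr2; rewrite expr2; exact: cvgM.
      rewrite (is_cvg_limn_einfE (cvgP _ XYn)) (cvg_lim _ XYn)//.
      by rewrite lee_fin -sqrrN opprB.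
  apply: le_trans (fatou P measurableT _ _) _ => //.
    by move=> m x _; rewrite lee_fin sqr_ge0.
  rewrite limn_einf_lim; apply: lime_le; first exact: is_cvg_einfs.
  (* The infimum over indices from [k] on is bounded by its term at [maxn k n], where the Cauchy
     bound at [n] applies. *)
  apply: nearW => k; apply: (@le_trans _ _
      (\int[P]_x ((X (maxn k n) x - X n x) ^+ 2)%:E)%E).
    by apply: ereal_inf_lbound; exists (maxn k n) => //=; exact: leq_maxl.
  have := cX _ _ (leq_maxr k n); rewrite -lee_fin ip_EFin.
  by under eq_integral do rewrite -expr2.
have YL : Y \in Lfun P 2%:E.
  rewrite (_ : Y = (X 0%N : T -> R) - (fun x => X 0%N x - Y x)); last first.
    by apply/funext => x /=; rewrite fctE subKr.
  apply: rpredB; [exact: lee1n|move=> ?; exact: LfunP|move=> ?].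
  apply: in_Lfun2; first exact: measurable_funB.
  exact: le_lt_trans (YX 0%N) (ltry _).
exists (Lfun_Sub (lee1n 2) YL) => n.
rewrite -lee_fin ip_EFin; apply: le_trans (YX n).
by under eq_integral do rewrite -expr2.
Qed.

End L2.

Lemma le0_geometric {R : realType} (x K : R) :
  (forall n, x <= K * 2^-1 ^+ n) -> x <= 0.
Proof.
move=> xK; have K0 : (fun n => K * 2^-1 ^+ n : R^o) @ \oo --> (0 : R^o).
  by apply: cvg_geometric; rewrite ger0_norm ?invf_lt1// ltr1n.
rewrite -(cvg_lim _ K0)//; apply: limr_ge; first exact: cvgP K0.
exact: nearW.
Qed.

(** * Riesz representation by a minimizing sequence *)

Section Riesz.
Context {d : measure_display} {T : measurableType d} {R : realType}.
Context {P : probability T R}.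

Local Notation L2 := (LfunType P (lee1n 2)).

(* The pairs (X, c) prescribe the inner products <Y, X> = c; Y is the limit of
   a minimizing sequence of k - 2 c + <X, X>, the formal squared distance. *)
Lemma L2_riesz (M : set (L2 * R)) (k : R) :
  M (0, 0) ->
  (forall a u v, M u -> M v -> M (a *: u.1 + v.1, a * u.2 + v.2)) ->
  (forall u, M u -> 0 <= k - 2 * u.2 + ip u.1 u.1) ->
  exists Y : L2, [/\ forall u, M u -> ip Y u.1 = u.2, ip Y Y <= k &
    forall W, (forall u, M u -> ip u.1 W = 0) -> ip Y W = 0].
Proof.
move=> M0 Mlin Mk; pose q (u : L2 * R) := k - 2 * u.2 + ip u.1 u.1.
have qlb : has_lbound (q @` M) by exists 0 => _ [u /Mk ? <-].
have hinf : has_inf (q @` M) by split => //; exists (q (0, 0)); exists (0, 0).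
pose delta := inf (q @` M).
have qdelta u : M u -> delta <= q u by move=> Mu; apply: ge_inf => //; exists u.
pose e n : R := 4^-1 ^+ n.
have e0 n : 0 < e n by rewrite exprn_gt0.
have : forall n, exists u, M u /\ q u < delta + e n / 4.
  move=> n; have e40 : 0 < e n / 4 by rewrite divr_gt0.
  by have [_ [u Mu <-] qu] := inf_adherent e40 hinf; exists u.
move=> /choice[u /all_and2[Mu qu]].
have M2 a v w : M v -> M w -> M (a *: (v.1 + w.1), a * (v.2 + w.2)).
  move=> Mv Mw; have := Mlin a _ (0, 0) (Mlin 1 _ _ Mv Mw) M0.
  by rewrite /= scale1r mul1r !addr0.
have [n m nm|Y uY] := L2_complete (X := fun n => (u n).1).
  (* Parallelogram law: [q] at the midpoint is at least [delta], so the squared distance is at most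
     [(e m + e n) / 2]. This is why [u] is chosen within [e n / 4] of the infimum. *)
  have := qdelta _ (M2 2^-1 _ _ (Mu m) (Mu n)).
  have := qu n; have := qu m; have em : e m <= e n.
    by rewrite /e ler_wiXn2l// ?invr_ge0// invf_le1// ler1n.
  rewrite /q /= !(ipDl, ipDr, ipNl, ipNr, ipZl, ipZr) (ipC (u n).1 (u m).1) -/(e n).
  lra.
pose t n : R := 2^-1 ^+ n.
have t0 n : 0 < t n by rewrite exprn_gt0.
have et n : e n = t n ^+ 2 by rewrite /e /t -exprM mulnC exprM; congr (_ ^+ n); field.
have near_Y W n : `|ip ((u n).1 - Y) W| <= (1 + ip W W) * t n.
  have := norm_ip_AMGM (t n) ((u n).1 - Y) W; have := uY n; rewrite -/(e n) et.
  have := t0 n; have := ip_ge0 W; have := normr_ge0 (ip ((u n).1 - Y) W).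
  set a := `|_|; set b := ip W W; set c := ip _ _; nra.
have near_c v n : M v -> `|ip (u n).1 v.1 - v.2| <= (1 + ip v.1 v.1) * t n.
  move=> Mv.
  (* First-order optimality: moving from [u n] by [s] times [v] cannot take [q] below [delta]. The
     steps [s = t n] and [s = - t n], with [t n ^+ 2 = e n], bound the linear coefficient. *)
  have qt s : 0 <= e n + 2 * s * (ip (u n).1 v.1 - v.2) + s ^+ 2 * ip v.1 v.1.
    have := qdelta _ (Mlin s _ _ Mv (Mu n)); have := qu n; have := e0 n.
    rewrite /q /= !(ipDl, ipDr, ipZl, ipZr) (ipC v.1 (u n).1); lra.
  have := qt (t n); have := qt (- t n); rewrite et.
  have := t0 n; have := ip_ge0 v.1; set b := ip v.1 v.1; set c := _ - _.
  by have [?|?] := ger0P c; nra.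
have YM v : M v -> ip Y v.1 = v.2.
  move=> Mv; apply/eqP; rewrite -subr_eq0 -normr_le0.
  apply: (le0_geometric (K := 2 * (1 + ip v.1 v.1))) => n.
  have := near_Y v.1 n; have := near_c v n Mv; rewrite ipDl ipNl.
  rewrite -/(t n) !ler_norml; lra.
exists Y; split => //.
(* Since [(u n).2 = ip Y (u n).1], completing the square in the hypothesis at [u n] gives
   [ip Y Y - k <= e n]. *)
- rewrite -subr_le0; apply: (le0_geometric (K := 1)) => n.
  have := uY n; have := Mk _ (Mu n); rewrite !(ipDl, ipDr, ipNl, ipNr).
  rewrite (ipC _ Y) (YM _ (Mu n)) -/(t n) -/(e n) et.
  have : t n <= 1 by rewrite /t exprn_ile1// ?invr_ge0// invf_le1// ler1n.
  have := t0 n; nra.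
- move=> W MW; apply/eqP; rewrite -normr_le0.
  apply: (le0_geometric (K := 1 + ip W W)) => n.
  by have := near_Y W n; rewrite ipDl ipNl (MW _ (Mu n)) add0r normrN.
Qed.

End Riesz.

(** * Random fields with prescribed covariance *)

Section random_field.
Context {S : choiceType} {R : realType}.

Local Notation P := (@coin_measure S R).
Local Notation L2 := (LfunType P (lee1n 2)).

Lemma measurable_cylinder (A : set (coins S)) : cylinder A ->
  measurable (A : set (coinsT (S := S))).
Proof. by move=> cA; exact: sub_sigma_algebra. Qed.

Definition spin (A : set (coinsT (S := S))) (w : coinsT (S := S)) : R :=
  2 * \1_A w - 1.

Lemma spinE (b : coins S -> bool) w :
  spin [set u | b u] w = if b w then 1 else -1.
Proof.
rewrite /spin indicE (_ : (w \in _) = b w); first by case: (b w) => /=; ring.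
by apply/idP/idP; rewrite inE.
Qed.

Lemma spin_sqr A w : spin A w ^+ 2 = 1.
Proof. by rewrite /spin indicE; case: (_ \in _) => /=; ring. Qed.

Lemma spin_mean A : measurable A -> P A = 2^-1%:E ->
  (\int[P]_w spin A w)%R = 0.
Proof.
move=> mA PA; rewrite /spin RintegralB//.
- rewrite RintegralZl//; last exact: integrable_indic.
  rewrite Rintegral_cst//= probability_setT /Rintegral integral_indic//= setIT.
  rewrite PA /=.
  by field.
- rewrite (_ : _ \o _ = fun w => 2%:E * (\1_A w)%:E)%E//.
  by apply: integrableZl => //; exact: integrable_indic.
- exact: finite_measure_integrable_cst.
Qed.

Lemma spin_L2 A : measurable A -> spin A \in Lfun P 2%:E.
Proof.
move=> mA; apply: in_Lfun2.
  by apply: measurable_funB => //; apply: measurable_funM.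
under eq_integral do rewrite spin_sqr.
by rewrite (integral_cst P measurableT) /= probability_setT mule1 ltry.
Qed.

Definition rademacher (s : S) : L2 :=
  Lfun_Sub (lee1n 2) (spin_L2 (measurable_cylinder (cylinder_head s))).

Definition L2_one : L2 := Lfun_Sub (lee1n 2) (Lfun_cst P 1 2).

Lemma rademacher_centered s : ip (rademacher s) L2_one = 0.
Proof.
have mA := measurable_cylinder (cylinder_head s).
rewrite -(spin_mean mA (coin_measure_head s)).
by apply: eq_Rintegral => w _ /=; rewrite mulr1.
Qed.

Lemma rademacher_norm s : ip (rademacher s) (rademacher s) = 1.
Proof.
rewrite /ip (@eq_Rintegral _ _ _ _ _ (cst 1)) => [|w _]; last exact: spin_sqr.
by rewrite Rintegral_cst//= probability_setT mulr1.
Qed.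

(** The product of two signs is the sign of the event that the coins agree, which has probability
    1/2. *)
Lemma rademacher_orthogonal s t : s != t -> ip (rademacher s) (rademacher t) = 0.
Proof.
move=> st; have mA := measurable_cylinder (cylinder_agree s t).
rewrite -(spin_mean mA (coin_measure_agree st)).
apply: eq_Rintegral => w _ /=; rewrite (spinE (fun w => w s == w t)).
rewrite (spinE (fun w => w s)) (spinE (fun w => w t)).
by case: (w s); case: (w t) => /=; ring.
Qed.

Context (K : S -> S -> R).
Context (Ksym : forall s t, K s t = K t s).
Context (Kpos : forall l : seq (R * S),
  0 <= \sum_(x <- l) \sum_(y <- l) x.1 * y.1 * K x.2 y.2).

Let dom (G : set (S * L2)) (s : S) := exists X, G (s, X).

(* The last condition leaves every coin outside the domain of [G] available as
   a direction orthogonal to the field built so far. *)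
Let good (G : set (S * L2)) := [/\
  forall u v, G u -> G v -> ip u.2 v.2 = K u.1 v.1,
  forall u, G u -> ip u.2 L2_one = 0 &
  forall u t, G u -> ~ dom G t -> ip u.2 (rademacher t) = 0].

Let good_extend G s : good G -> ~ dom G s -> exists X, good (G `|` [set (s, X)]).
Proof.
move=> [GK G1 Gr] nGs.
pose inG (l : seq (R * (S * L2))) := forall x, x \in l -> G x.2.
(* The inner products with the new variable that linearity forces on the span of [G]. Pairs avoid
   having to show first that the value depends only on the vector. *)
pose M (u : L2 * R) := exists l, [/\ inG l,
  u.1 = \sum_(x <- l) x.1 *: x.2.2 & u.2 = \sum_(x <- l) x.1 * K s x.2.1].
have MG v : G v -> M (v.2, K s v.1).
  move=> Gv; exists [:: (1, v)]; split=> /= [x /[!inE]/eqP->//||];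
  by rewrite big_seq1 ?scale1r ?mul1r.
have [||u|Y [YK Yle Yperp]] := @L2_riesz _ _ _ P M (K s s).
- by exists [::]; split; rewrite ?big_nil.
- move=> a u v [l [Gl l1 l2]] [l' [Gl' l1' l2']].
  exists ([seq (a * x.1, x.2) | x <- l] ++ l'); split.
  + move=> x; rewrite mem_cat => /orP[/mapP[y ly ->]|/Gl'//]; exact: Gl ly.
  + rewrite big_cat big_map /= l1 l1' scaler_sumr.
    by congr (_ + _); apply: eq_bigr => x _; rewrite scalerA.
  + rewrite big_cat big_map /= l2 l2' mulr_sumr.
    by congr (_ + _); apply: eq_bigr => x _; rewrite mulrA.
- move=> [l [Gl -> ->]].
  (* Giving [s] the weight -1 turns positivity of [K] into the lower bound required by
     [L2_riesz]. *)
  have := Kpos ((-1, s) :: [seq (x.1, x.2.1) | x <- l]).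
  rewrite !big_cons !big_map /=.
  under [X in _ <= _ + X]eq_bigr do rewrite big_cons big_map /=.
  rewrite big_split /= ip_sumZl.
  have -> : \sum_(x <- l) x.1 * ip x.2.2 (\sum_(y <- l) y.1 *: y.2.2) =
      \sum_(x <- l) \sum_(y <- l) x.1 * y.1 * K x.2.1 y.2.1.
    apply: eq_big_seq => x /Gl Gx; rewrite ipC ip_sumZl mulr_sumr.
    by apply: eq_big_seq => y /Gl Gy; rewrite mulrA (GK _ _ Gy Gx) Ksym.
  have -> : \sum_(x <- l) x.1 * -1 * K x.2.1 s =
      - \sum_(x <- l) x.1 * K s x.2.1.
    by rewrite -sumrN; apply: eq_bigr => x _; rewrite Ksym mulrN1 mulNr.
  have -> : \sum_(x <- l) -1 * x.1 * K s x.2.1 =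
      - \sum_(x <- l) x.1 * K s x.2.1.
    by rewrite -sumrN; apply: eq_bigr => x _; rewrite mulN1r mulNr.
  lra.
(* The missing second moment, to be carried by the coin [s], which is orthogonal to [Y]. *)
pose c := Num.sqrt (K s s - ip Y Y).
have c2 : c ^+ 2 = K s s - ip Y Y by rewrite sqr_sqrtr// subr_ge0.
have YG v : G v -> ip Y v.2 = K s v.1 by move=> Gv; apply: YK (MG _ Gv).
have perp W : (forall v, G v -> ip v.2 W = 0) -> ip Y W = 0.
  move=> GW; apply: Yperp => u [l [Gl -> _]]; rewrite ip_sumZl.
  elim: l Gl => [|x l IH] Gl; first by rewrite big_nil.
  rewrite big_cons GW ?mulr0 ?add0r; last by apply: Gl; rewrite mem_head.
  by apply: IH => y ly; apply: Gl; rewrite in_cons ly orbT.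
have Ys : ip Y (rademacher s) = 0 by apply: perp => v Gv; exact: Gr.
exists (Y + c *: rademacher s); split => /=.
- have new v : G v -> ip v.2 (Y + c *: rademacher s) = K s v.1.
    by move=> Gv; rewrite ipDr ipZr (Gr v s)// mulr0 addr0 ipC YG.
  move=> u v [Gu|->] [Gv|->] /=; first exact: GK.
  + by rewrite new// Ksym.
  + by rewrite ipC new.
  + rewrite !(ipDl, ipDr, ipZl, ipZr) (ipC (rademacher s)) Ys rademacher_norm.
    by rewrite mulr0 !addr0 add0r mulr1 -expr2 c2 addrC subrK.
- move=> u [/G1//|->] /=.
  by rewrite ipDl ipZl rademacher_centered mulr0 addr0 perp.
- move=> u t uG nt.
  have nGt : ~ dom G t by move=> [X GX]; apply: nt; exists X; left.
  case: uG => [Gu|->] /=; first exact: Gr.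
  have st : s != t by apply/eqP => st; apply: nt; eexists; right; rewrite -st.
  rewrite ipDl ipZl rademacher_orthogonal// mulr0 addr0 perp// => v Gv.
  exact: Gr.
Qed.

(** Goodness involves at most two members of [G] at a time, and these lie in one set of a chain, so
    it passes to unions of chains. By [good_extend] a maximal good set has every index in its
    domain. *)
Theorem field_with_covariance : exists X : S -> L2,
  (forall s, ip (X s) L2_one = 0) /\ forall s t, ip (X s) (X t) = K s t.
Proof.
have [F FP totF|G [goodG Gmax]] := @Zorn_bigcup (S * L2)%type good.
  split.
  - move=> u v [A FA Au] [B FB Bv].
    have [AB|BA] := totF _ _ FA FB.
      by have [+ _ _] := FP _ FB; apply => //; exact: AB.
    by have [+ _ _] := FP _ FA; apply => //; exact: BA.
  - by move=> u [A FA Au]; have [_ + _] := FP _ FA; exact.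
  - move=> u t [A FA Au] nt; have [_ _] := FP _ FA; apply => //.
    by move=> [X AX]; apply: nt; exists X; exists A.
have /choice[X GX] : forall s, dom G s.
  move=> s; apply: contrapT => nGs; have [X goodX] := good_extend goodG nGs.
  apply: Gmax goodX; split; first by move=> u; left.
  by move=> /(_ (s, X) (or_intror erefl)) GX; apply: nGs; exists X.
have [GK G1 _] := goodG.
exists X; split => [s|s t]; first exact: G1 (GX s).
exact: GK (GX s) (GX t).
Qed.

End random_field.

(** * Matrix-valued kernels *)

Section quadratic_forms.
Context {R : realType} {S : Type}.
Implicit Types (K : S -> S -> R) (l : seq (R * S)).

Definition qform K l : R := \sum_(x <- l) \sum_(y <- l) x.1 * y.1 * K x.2 y.2.

(** When the total weight is zero the [g] terms cancel and the form changes sign; both directions of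
    the decomposition rest on this. *)
Lemma qform_decomp K (g : S -> R) l :
  qform (fun s t => g s + g t - K s t) l =
  2 * (\sum_(x <- l) x.1) * (\sum_(x <- l) x.1 * g x.2) - qform K l.
Proof.
have -> : qform (fun s t => g s + g t - K s t) l =
    \sum_(x <- l) (x.1 * g x.2 * (\sum_(y <- l) y.1) +
    x.1 * (\sum_(y <- l) y.1 * g y.2) - \sum_(y <- l) x.1 * y.1 * K x.2 y.2).
  apply: eq_bigr => x _; rewrite !mulr_sumr -big_split -sumrB /=.
  by apply: eq_bigr => y _; ring.
by rewrite sumrB big_split /= -!mulr_suml; congr (_ - _); ring.
Qed.

(** A point where the kernel vanishes can be added with any weight, in particular the one that makes
    the total zero. *)
Lemma qform_cons_eq0 K a s l : (forall t, K s t = 0) -> (forall t, K t s = 0) ->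
  qform K ((a, s) :: l) = qform K l.
Proof.
move=> Ksl Ksr; rewrite /qform big_cons big1 ?add0r => [|y _]; last first.
  by rewrite Ksl mulr0.
by apply: eq_bigr => x _; rewrite big_cons Ksr mulr0 add0r.
Qed.

End quadratic_forms.

Section matrix_kernels.
Context {R : realType} {d m : nat}.
Implicit Types K : mkernel R d m.

Let S := ('cV[R]_d * 'I_m)%type.

(** Reading a matrix kernel as a scalar kernel on pairs (location, component) turns vector weights
    into scalar ones, and the constraint on the vectors into zero total weight. *)
Definition flat K (s t : S) : R := K s.1 t.1 s.2 t.2.

Lemma mkernel_form_seq n (x : 'I_n -> 'cV[R]_d) (a : 'I_n -> 'cV[R]_m) :
  exists l : seq (R * S), (forall K, mkernel_form K x a = qform (flat K) l) /\
  \sum_(y <- l) y.1 = ((const_mx 1 : 'cV[R]_m)^T *m (\sum_(k < n) a k)) 0 0.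
Proof.
pose l : seq (R * S) :=
  [seq (a k p 0, (x k, p)) | k <- enum 'I_n, p <- enum 'I_m].
have sumE F : \sum_(y <- l) F y =
    \sum_(k < n) \sum_(p < m) F (a k p 0, (x k, p)) :> R.
  by rewrite big_allpairs_dep big_enum; apply: eq_bigr => k _; rewrite big_enum.
exists l; split=> [K|].
  rewrite /qform sumE; apply: eq_bigr => i _.
  under [RHS]eq_bigr do rewrite sumE.
  rewrite exchange_big /=; apply: eq_bigr => j _; rewrite exchange_big /=.
  rewrite mxE; apply: eq_bigr => q _; rewrite mxE mulr_suml.
  by apply: eq_bigr => p _; rewrite mxE /flat /=; ring.
rewrite sumE mulmx_sumr summxE; apply: eq_bigr => k _.
by rewrite mxE; apply: eq_bigr => p _; rewrite !mxE mul1r.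
Qed.

(** Each weighted pair becomes its location with a multiple of a basis vector; locations may
    repeat. *)
Lemma qform_mkernel (l : seq (R * S)) :
  exists n (x : 'I_n -> 'cV[R]_d) (a : 'I_n -> 'cV[R]_m),
    (forall K, mkernel_form K x a = qform (flat K) l) /\
    (const_mx 1 : 'cV[R]_m)^T *m (\sum_(k < n) a k) = (\sum_(y <- l) y.1)%:M.
Proof.
pose e k := tnth (in_tuple l) k.
exists (size l), (fun k => (e k).2.1), (fun k => (e k).1 *: delta_mx (e k).2.2 0).
split=> [K|].
  rewrite /qform [RHS]big_tnth; apply: eq_bigr => i _; rewrite [RHS]big_tnth.
  apply: eq_bigr => j _; rewrite [(_ *: _)^T]linearZ /= trmx_delta -!scalemxAl.
  by rewrite -scalemxAr -rowE -colE !mxE mulrA.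
apply/matrixP => i j; rewrite !ord1 mulmx_sumr summxE mxE eqxx mulr1n [RHS]big_tnth.
apply: eq_bigr => k _; rewrite -scalemxAr mxE -colE !mxE.
by rewrite mulr1.
Qed.

Lemma posdef_mkernelP K : posdef_mkernel K <->
  sym_mkernel K /\ forall l, 0 <= qform (flat K) l.
Proof.
split=> -[Ksym Kpos]; split=> //.
  by move=> l; have [n [x [a [<- _]]]] := qform_mkernel l; exact: Kpos.
by move=> n x a; have [l [-> _]] := mkernel_form_seq x a.
Qed.

Lemma cond_negdef_mkernelP K : cond_negdef_mkernel K <->
  sym_mkernel K /\
  forall l, \sum_(y <- l) y.1 = 0 -> qform (flat K) l <= 0.
Proof.
split=> -[Ksym Kneg]; split=> //.
  move=> l l0; have [n [x [a [<- a0]]]] := qform_mkernel l; apply: Kneg.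
  by rewrite a0 l0 raddf0.
move=> n x a a0; have [l [-> l0]] := mkernel_form_seq x a.
by apply: Kneg; rewrite l0 a0 mxE.
Qed.

Lemma flat_sym K : sym_mkernel K -> forall s t, flat K s t = flat K t s.
Proof. by move=> Ksym s t; exact: Ksym. Qed.

Lemma cond_negdef_decomp K : cond_negdef_mkernel K ->
  exists (g : 'I_m -> 'cV[R]_d -> R) (C : mkernel R d m),
    posdef_mkernel C /\ variogram_decomp K g C.
Proof.
move=> /cond_negdef_mkernelP[Ksym Kneg].
(* For [m = 0] there is no component to form a base point, and everything is trivial. *)
have [i0 _|noI] := pickP 'I_m; last first.
  exists (fun _ _ => 0), (fun _ _ => 0); split => [|x y k]; last by have := noI k.
  split=> [x y k|n x a]; first by have := noI k.
  rewrite /mkernel_form big1// => k _; rewrite big1// => k' _.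
  by rewrite mulmx0 mul0mx mxE.
pose s0 : S := (0, i0).
(* Subtracting half the value at the base point makes [C] vanish whenever one argument is [s0]. *)
pose g (s : S) := flat K s s0 - flat K s0 s0 / 2.
pose C : mkernel R d m := fun x y => \matrix_(i, j) (g (x, i) + g (y, j) - K x y i j).
have CE : flat C = fun s t => g s + g t - flat K s t.
  by apply/funext => -[x i]; apply/funext => -[y j]; rewrite /flat mxE.
exists (fun i x => g (x, i)), C; split; last by move=> x y i j; rewrite mxE; ring.
apply/posdef_mkernelP; split=> [x y i j|l].
  by rewrite !mxE (Ksym x y i j); ring.
have C0 t : flat C s0 t = 0 /\ flat C t s0 = 0.
  by rewrite CE /g (flat_sym Ksym s0 t); split; field.
rewrite -(qform_cons_eq0 (- \sum_(y <- l) y.1) l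
  (fun t => (C0 t).1) (fun t => (C0 t).2)).
set l' := _ :: l; have l'0 : \sum_(y <- l') y.1 = 0 by rewrite big_cons addNr.
by rewrite CE qform_decomp l'0 mulr0 mul0r sub0r oppr_ge0 Kneg.
Qed.

Lemma decomp_cond_negdef K (g : 'I_m -> 'cV[R]_d -> R) (C : mkernel R d m) :
  posdef_mkernel C -> variogram_decomp K g C -> cond_negdef_mkernel K.
Proof.
move=> /posdef_mkernelP[Csym Cpos] KgC; apply/cond_negdef_mkernelP; split.
  by move=> x y i j; rewrite !KgC Csym [g i x + _]addrC.
move=> l l0; have -> : flat K = fun s t => g s.2 s.1 + g t.2 t.1 - flat C s t.
  by apply/funext => s; apply/funext => t; exact: KgC.
by rewrite (qform_decomp _ (fun s : S => g s.2 s.1)) l0 mulr0 mul0r sub0r oppr_le0.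
Qed.

Lemma decomp_variogram K (g : 'I_m -> 'cV[R]_d -> R) (C : mkernel R d m) :
  posdef_mkernel C -> variogram_decomp K g C ->
  (forall x i, K x x i i = 0) -> pseudo_cross_variogram K.
Proof.
move=> /posdef_mkernelP[Csym Cpos] KgC K0.
have [X [X1 XC]] := field_with_covariance (flat_sym Csym) Cpos.
(* The zero diagonal determines [g], so [K] is half the second moment of the difference of two
   centered variables with covariance [C]. *)
have gE x i : g i x = C x x i i / 2 by have := KgC x x i i; rewrite K0; lra.
exists _, _, (@coin_measure S R), (fun i x => X (x, i)) => x y i j.
pose D := X (x, i) - X (y, j).
have DL : (X (x, i) \- X (y, j) : _ -> R) \in Lfun (@coin_measure S R) 2%:E.
  exact: (LfunP D).
split=> //; rewrite varianceE//.
have -> : 'E_(@coin_measure S R)[(X (x, i) \- X (y, j)) ^+ 2]%E = (ip D D)%:E.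
  by rewrite ip_EFin unlock.
have -> : 'E_(@coin_measure S R)[(X (x, i) \- X (y, j))]%E = (ip D L2_one)%:E.
  by rewrite ip_EFin unlock; apply: eq_integral => w _ /=; rewrite mulr1.
rewrite -EFin_expe -EFinB -EFinM /D !(ipDl, ipDr, ipNl, ipNr) !X1 !XC KgC !gE.
rewrite (flat_sym Csym (y, j)) /flat /=; congr EFin; by field.
Qed.

End matrix_kernels.

Theorem theorem3p1 (R : realType) (d m : nat) :
  (forall gamma : mkernel R d m,
     cond_negdef_mkernel gamma ->
     exists (g : 'I_m -> 'cV[R]_d -> R) (C : mkernel R d m),
       posdef_mkernel C /\ variogram_decomp gamma g C) /\
  (forall gamma : mkernel R d m,
     (exists (g : 'I_m -> 'cV[R]_d -> R) (C : mkernel R d m),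
        posdef_mkernel C /\ variogram_decomp gamma g C) ->
     cond_negdef_mkernel gamma /\
     ((forall (x : 'cV[R]_d) (i : 'I_m), gamma x x i i = 0%R) ->
      pseudo_cross_variogram gamma)).
Proof.
split=> [|gamma [g [C [Cpos decomp]]]]; first exact: cond_negdef_decomp.
split; first exact: decomp_cond_negdef decomp.
exact: decomp_variogram decomp.
Qed.
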